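(* Let $n\ge 5$ and let $W$ be an $\mathbb{F}_2$-subspace of $\mathbb{F}_{2^n}$ such that $K_n(v)=0$ for all $v\in W$. Then $\dim W\le d$, where $d=\frac{n-2}{2}$ if $n\equiv 0,2,4,6\pmod 8$; $d=\frac{n-1}{2}$ if $n\equiv 1,7\pmod 8$; and $d=\frac{n-3}{2}$ if $n\equiv 3,5\pmod 8$.
   Context: $\mathrm{Tr}$ is the absolute trace $\mathbb{F}_{2^n}\to\mathbb{F}_2$, with convention $0^{-1}=0$. The Kloosterman sum of $a\in\mathbb{F}_{2^n}$ is $K_n(a)=\sum_{x\in\mathbb{F}_{2^n}}(-1)^{\mathrm{Tr}(x^{-1}+ax)}$. *)

(* Defs.v *)
From HB Require Import structures.
From mathcomp Require Import all_boot all_order all_algebra.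
From mathcomp Require Import all_fingroup all_solvable all_field.

Set Implicit Arguments.
Unset Strict Implicit.
Unset Printing Implicit Defensive.

Import GRing.Theory.
Local Open Scope ring_scope.

(* For F : finFieldType of characteristic 2, pPrimeCharType charF is F itself,
   seen as a splitting field over its prime field 'F_2; its elements are the
   elements of F and its {vspace _} are the F_2-subspaces of F. *)

Section Kloosterman.

Variables (F : finFieldType) (charF : 2%N \in [pchar F]).
Let L : splittingFieldType 'F_2 := pPrimeCharType charF.

(* MathComp's trace of F over F_2 is an element of F lying in the prime
   subfield {0, 1}; absTr is the corresponding element of 'F_2 (see
   absTr_galTrace), and absTr_Frobenius gives the Frobenius-sum formula. *)
Definition absTr (x : F) : 'F_2 := (galTrace 1 {:L} x != 0)%:R.

(* 'F_2 is a type of ordinals, so absTr t is used as the exponent 0 or 1; and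
   the inverse of 0 is 0 in MathComp. *)
Definition Kloosterman (a : F) : int :=
  \sum_(x : F) (-1) ^+ absTr (x^-1 + a * x).

Lemma absTr_galTrace (x : F) : (absTr x)%:A = galTrace 1 {:L} x :> L.
Proof.
have /mem_galTrace/(_ (memvf (x : L)))/vlineP[c Ec] :
  galois 1 {:L} by apply: finField_galois; apply: sub1v.
rewrite /absTr Ec scaler_eq0 oner_eq0 orbF.
by case: c {Ec} => [[|[|[]]] //= lt_c2]; congr (_ *: _); apply: val_inj.
Qed.

Lemma absTr_Frobenius (n : nat) (cardF : #|F| = (2 ^ n)%N) (x : F) :
  (absTr x)%:A = \sum_(i < n) x ^+ (2 ^ i) :> L.
Proof.
have dimL : \dim {:L} = n.
  apply: (@expnI 2) => //; rewrite -cardF.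
  have := @card_vspacef _ F (Vector.on L).
  by rewrite card_vspace card_Fp.
have sKE : (1 <= {:L})%VS by apply: sub1v.
have [f genf Df] := finField_galois_generator sKE.
have {}Df (y : L) : f y = y ^+ 2 by rewrite Df ?memvf // dimv1 card_Fp.
have ord_f : #[f]%g = n.
  by rewrite orderE -(eqP genf) -galois_dim ?finField_galois // dimv1 divn1.
have Dfi i (y : L) : (f ^+ i)%g y = y ^+ (2 ^ i).
  elim: i => [|i IHi]; first by rewrite expg0 gal_id.
  by rewrite expgSr galM ?memvf // IHi Df -exprM -expnSr.
rewrite absTr_galTrace /galTrace (eqP genf).
have -> : <[f]>%g = [set (f ^+ i)%g | i : 'I_n].
  apply/setP=> g; apply/idP/imsetP => [/cyclePmin[i]|[i _ ->]].
    by rewrite ord_f => lt_i_n ->; exists (Ordinal lt_i_n).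
  exact: mem_cycle.
rewrite big_imset /=; first by apply: eq_bigr => i _; apply: Dfi.
move=> i j _ _ /eqP; rewrite eq_expg_mod_order ord_f !modn_small //.
by move/eqP/val_inj.
Qed.

End Kloosterman.

(* Main.v *)
(* Let q = 2 ^ n, let T be the trace to F_2, and let N(a, b) be the number of x
   with T(a x) = T(b x) = T(1 / x) = 1.  Then K(a) = 4 N(a, a) - q for a != 0,
   N(a + b, a + b) + 2 N(a, b) = N(a, a) + N(b, b), and expanding the three
   traces into power sums gives N(a, b) = T(a b) mod 2.  Since n >= 5, a space W
   of zeros of K is thus self-orthogonal for the form T(a b), so 2 dim W <= n.

   If 2 dim W = n, then W is its own orthogonal and contains 1.  But K(1) is not
   0: the 2-adic valuation of N(1, 1) is that of n, since N(1, 1) doubles along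
   each quadratic extension, up to Frobenius orbits, via x |-> x + 1 / x.

   If 2 dim W = n - 1, let V be the inverse image of W under v |-> v^2 + v.  As
   N(v^2 + v, v^2 + v) = 2 (T(v) + T(v^3)) mod 4, the form T(v^3 + v) vanishes on
   V, and V is its own orthogonal for the associated bilinear form, whence the
   sum of (-1)^T(x^3 + x) is #|V| = 2 ^ ((n + 1) / 2).  This sum is also equal to
   4 - q mod 5, because translation by a rational 5-torsion point acts freely on
   the points of y^2 + y = x^3 + x with x != 0, 1; this is contradictory unless
   n = 1, 7 mod 8. *)
Require Import Defs.
From HB Require Import structures.
From mathcomp Require Import all_boot all_order all_algebra.
From mathcomp Require Import all_fingroup all_solvable all_field.
From mathcomp Require Import ring zify.

Set Implicit Arguments.
Unset Strict Implicit.
Unset Printing Implicit Defensive.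

Import GRing.Theory.
Local Open Scope ring_scope.

(** * Divisibility of cardinals by orbit lengths *)

Lemma dvdn_card_iter (T : finType) (f : T -> T) (S : {set T}) (p j : nat) :
    prime p -> {in S, forall x, f x \in S} ->
    {in S, forall x, iter (p ^ j.+1) f x = x} ->
    {in S, forall x, iter (p ^ j) f x != x} ->
  (p ^ j.+1 %| #|S|)%N.
Proof.
move=> p_pr fS fper fnofix; set N := (p ^ j.+1)%N.
have N_gt0 : (0 < N)%N by rewrite expn_gt0 prime_gt0.
(* Extended by the identity outside [S], [f] becomes a permutation. An orbit in [S] has length
   dividing [p ^ j.+1] but not [p ^ j], hence exactly [p ^ j.+1]. *)
pose g x := if x \in S then f x else x.
have iterS i x : x \in S -> iter i g x = iter i f x /\ iter i f x \in S.
  move=> xS; elim: i => [|i [IHi Si]] //=.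
  by rewrite IHi /g Si; split=> //; apply: fS.
have iterNS i x : x \notin S -> iter i g x = x.
  by move=> xS; elim: i => //= i ->; rewrite /g (negPf xS).
have gper x : iter N g x = x.
  have [xS|xS] := boolP (x \in S); last exact: iterNS.
  by rewrite (iterS _ _ xS).1 fper.
have g_inj : injective g.
  move=> x y gxy; rewrite -(gper x) -(gper y) -(prednK N_gt0) !iterSr.
  by rewrite gxy.
have g_order x : x \in S -> fingraph.order g x = N.
  move=> xS.
  have iter_mod i : iter i g x = iter (i %% fingraph.order g x) g x.
    rewrite {1}(divn_eq i (fingraph.order g x)) addnC iterD.
    congr (iter _ g _); elim: (i %/ _)%N => // k IHk.
    by rewrite mulSn iterD IHk iter_order.
  have dvd_order i : iter i g x = x -> (fingraph.order g x %| i)%N.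
    rewrite iter_mod => fix_x; apply/eqP.
    have lt_i : (i %% fingraph.order g x < fingraph.order g x)%N.
      by rewrite ltn_mod fingraph.order_gt0.
    by rewrite -(findex_iter lt_i) fix_x findex0.
  have /(dvdn_pfactor _ _ p_pr)[k le_k Dk] := dvd_order _ (gper x).
  rewrite Dk /N; congr (p ^ _)%N; apply/eqP; rewrite eqn_leq le_k ltnNge.
  apply: contra (fnofix x xS) => le_kj.
  rewrite -(iterS _ _ xS).1 iter_mod Dk (eqP (dvdn_exp2l p le_kj)).
  by rewrite eqxx.
have subS : S \subset order_set g N by apply/subsetP=> x /g_order; rewrite inE => ->.
have closS : fclosed g S.
  move=> x _ /eqP <-; have [xS|xS] := boolP (x \in S).
    by rewrite /g xS fS.
  by rewrite /g (negPf xS) (negPf xS).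
by rewrite -(fcard_order_set g_inj subS closS) dvdn_mull.
Qed.

(* [ftrace k] is the trace of F_(2^k) over F_2 only on the subfield
   x ^+ (2 ^ k) = x. *)
Definition ftrace (R : pzRingType) k (x : R) : R := \sum_(i < k) x ^+ (2 ^ i).

Section FieldTrace.

Variables (F : finFieldType) (charF : 2%N \in [pchar F]).

(** * Power-sum traces and Artin-Schreier equations *)

Lemma char2_eq0 : 1 + 1 = 0 :> F. Proof. exact: addrr_pchar2. Qed.

Lemma char2_eq (x y : F) : (x == y) = (x + y == 0).
Proof. by rewrite -[in RHS](oppr_pchar2 charF y) subr_eq0. Qed.

Lemma expr2nD i (x y : F) : (x + y) ^+ (2 ^ i) = x ^+ (2 ^ i) + y ^+ (2 ^ i).
Proof. by apply: exprDn_pchar; rewrite pnatX (pnatE _ (isT : prime 2)) charF. Qed.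

Lemma ftraceD k (x y : F) : ftrace k (x + y) = ftrace k x + ftrace k y.
Proof. by rewrite -big_split; apply: eq_bigr => i _; apply: expr2nD. Qed.

Lemma ftrace0 k : ftrace k (0 : F) = 0.
Proof. by apply: big1 => i _; rewrite expr0n expn_eq0. Qed.

Lemma ftrace_sum k (I : finType) (P : pred I) (f : I -> F) :
  ftrace k (\sum_(i | P i) f i) = \sum_(i | P i) ftrace k (f i).
Proof. by apply: big_morph; [apply: ftraceD | apply: ftrace0]. Qed.

Lemma ftrace_exp2n k j (x : F) : ftrace k (x ^+ (2 ^ j)) = ftrace k x ^+ (2 ^ j).
Proof.
rewrite /ftrace [RHS](big_morph _ (expr2nD j) (id1 := 0)); last first.
  by rewrite expr0n expn_eq0.
by apply: eq_bigr => i _; rewrite -!exprM mulnC.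
Qed.

Lemma ftrace_add j k (x : F) :
  ftrace (j + k) x = ftrace j x + ftrace k (x ^+ (2 ^ j)).
Proof.
rewrite /ftrace big_split_ord; congr (_ + _); apply: eq_bigr => i _ /=.
by rewrite -exprM -expnD.
Qed.

Lemma ftrace_double k (x : F) : x ^+ (2 ^ k) = x -> ftrace (k + k) x = 0.
Proof. by move=> xk; rewrite ftrace_add xk addrr_pchar2. Qed.

Lemma ftraceM k r (x : F) : x ^+ (2 ^ k) = x -> ftrace (r * k) x = ftrace k x *+ r.
Proof.
move=> xk; elim: r => [|r IHr]; first by rewrite /ftrace big_ord0.
by rewrite mulSn ftrace_add xk IHr mulrS.
Qed.

Lemma ftrace1 k : ftrace k (1 : F) = k%:R.
Proof.
by rewrite /ftrace (eq_bigr _ (fun _ _ => expr1n _ _)) sumr_const card_ord.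
Qed.

Lemma ftrace1_odd k : odd k -> ftrace k (1 : F) = 1.
Proof.
move=> k_odd; rewrite ftrace1 -(odd_double_half k) k_odd -mul2n natrD natrM.
by rewrite (pcharf0 charF) mul0r addr0.
Qed.

(** Consecutive Frobenius powers cancel in pairs: the sum telescopes. *)
Lemma ftraceAS k (x : F) : ftrace k (x ^+ 2 + x) = x ^+ (2 ^ k) + x.
Proof.
elim: k => [|k IHk]; first by rewrite /ftrace big_ord0 addrr_pchar2.
rewrite -addn1 ftrace_add IHk /ftrace big_ord1 expn0 expr1 expr2nD addn1 expnS.
rewrite exprM; ring: char2_eq0.
Qed.

Lemma ftrace_bool k (x : F) :
  x ^+ (2 ^ k) = x -> (ftrace k x == 0) || (ftrace k x == 1).
Proof.
move=> xk; have := ftraceD k (x ^+ 2) x.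
rewrite ftraceAS xk addrr_pchar2 // (ftrace_exp2n k 1) => T2.
by rewrite [_ == 1]char2_eq -mulf_eq0 mulrDr mulr1 -expr2 -T2.
Qed.



Variables (n : nat) (n_gt0 : (0 < n)%N) (cardF : #|F| = (2 ^ n)%N).

Local Notation T := (@ftrace F n).

Lemma expr2n_card (x : F) : x ^+ (2 ^ n) = x.
Proof. by rewrite -cardF expf_card. Qed.

Lemma trace_bool x : (T x == 0) || (T x == 1).
Proof. exact/ftrace_bool/expr2n_card. Qed.

Lemma trace_neq0 x : (T x != 0) = (T x == 1).
Proof.
by case/orP: (trace_bool x) => /eqP->; rewrite ?eqxx ?oner_eq0 // eq_sym oner_eq0.
Qed.

Lemma trace_exp2n j x : T (x ^+ (2 ^ j)) = T x.
Proof.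
rewrite ftrace_exp2n; case/orP: (trace_bool x) => /eqP->; last exact: expr1n.
by rewrite expr0n expn_eq0.
Qed.

Lemma trace_sqr x : T (x ^+ 2) = T x. Proof. exact: (trace_exp2n 1). Qed.

Lemma card_AS_fiber (y0 : F) :
  #|[set y | y ^+ 2 + y == y0 ^+ 2 + y0]| = 2%N.
Proof.
have -> : [set y | y ^+ 2 + y == y0 ^+ 2 + y0] = [set y0; y0 + 1].
  apply/setP=> y; rewrite !inE [LHS]char2_eq [y == y0]char2_eq.
  rewrite [y == y0 + 1]char2_eq -mulf_eq0; congr (_ == 0).
  by ring: char2_eq0.
by rewrite cards2 [y0 == _]char2_eq addrA addrr_pchar2 // add0r oner_eq0.
Qed.

(** As a polynomial, the trace has degree 2^(n-1), which bounds its roots. *)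
Lemma card_trace0 : (#|[set x | T x == 0%R]| <= 2 ^ n.-1)%N.
Proof.
pose P : {poly F} := \sum_(i < n) 'X^(2 ^ i).
have sizeP : size P = (2 ^ n.-1).+1.
  rewrite /P; case: n n_gt0 => // m _; rewrite big_ord_recr /= addrC.
  rewrite size_polyDl size_polyXn // ltnS.
  apply: leq_trans (size_sum _ _ _) _; apply/bigmax_leqP=> i _.
  by rewrite size_polyXn ltn_exp2l.
rewrite cardE -ltnS -sizeP; apply: max_poly_roots; last exact: enum_uniq.
  by rewrite -size_poly_gt0 sizeP.
apply/allP=> x; rewrite mem_enum inE /root /P horner_sum => /eqP {2}<-.
by apply/eqP/eq_bigr=> i _; rewrite hornerXn.
Qed.

(** Additive Hilbert 90 by counting: y |-> y^2 + y is two-to-one, so its image has 2^(n-1) elements;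
    it lies in the kernel of T, which is no larger. *)
Lemma trace0_AS c : T c = 0 -> exists y : F, c = y ^+ 2 + y.
Proof.
pose AS (y : F) := y ^+ 2 + y; pose S := [set AS y | y : F].
have cardS : #|S| = (2 ^ n.-1)%N.
  suff: (#|F| = #|S| * 2)%N by rewrite cardF -{1}(prednK n_gt0) expnSr; lia.
  rewrite -[LHS]sum1_card (partition_big_imset AS) /= -/S.
  rewrite (eq_bigr (fun=> 2%N)) ?sum_nat_const // => _ /imsetP[y0 _ ->].
  by rewrite sum1_card -(card_AS_fiber y0); apply: eq_card => y; rewrite !inE.
have : S = [set x | T x == 0].
  apply/eqP; rewrite eqEcard cardS card_trace0 andbT.
  apply/subsetP=> _ /imsetP[y _ ->]; rewrite inE ftraceAS // expr2n_card.
  by rewrite addrr_pchar2.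
move/setP/(_ c); rewrite inE => eqS Tc; move: eqS; rewrite Tc eqxx.
by case/imsetP=> y _ ->; exists y.
Qed.

Lemma traceAS y : T (y ^+ 2 + y) = 0.
Proof. by rewrite ftraceAS // expr2n_card addrr_pchar2. Qed.

Lemma card_AS c : #|[set y : F | y ^+ 2 + y == c]| = (T c == 0%R).*2.
Proof.
have [/trace0_AS[y0 ->] | Tc] := eqVneq (T c) 0; first exact: card_AS_fiber.
apply: eq_card0 => y; rewrite inE; apply: contraNF Tc => /eqP <-.
by rewrite traceAS.
Qed.

Lemma trace_surj : exists c : F, T c = 1.
Proof.
have [c|T0] := pickP (fun c => T c == 1); first by move/eqP; exists c.
have := card_trace0; rewrite (_ : [set x | _] = setT).
  by rewrite cardsT cardF leq_exp2l // -ltnS prednK // ltnn.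
by apply/setP=> x; rewrite !inE -[_ == 0]negbK trace_neq0 T0.
Qed.

(** * The additive character and orthogonal complements *)

Definition chi (x : F) : int := (-1) ^+ (T x != 0).

Lemma chiD x y : chi (x + y) = chi x * chi y.
Proof.
rewrite /chi -signr_addb ftraceD //; congr (_ ^+ (nat_of_bool _)).
by case/orP: (trace_bool x) => /eqP->; case/orP: (trace_bool y) => /eqP->;
  rewrite ?addr0 ?add0r ?addrr_pchar2 ?eqxx ?oner_eq0.
Qed.

Lemma chi0 : chi 0 = 1. Proof. by rewrite /chi ftrace0 eqxx. Qed.


Lemma chi_eq1 x : (chi x == 1) = (T x == 0).
Proof. by rewrite /chi; case: (T x == 0). Qed.

Lemma chi_trace x y : T x = T y -> chi x = chi y.
Proof. by rewrite /chi => ->. Qed.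

(** Translation by [a0] permutes [A] and changes the sign of every term. *)
Lemma sum_chi_additive (A : {set F}) (f : F -> F) a0 :
    {in A &, forall x y, x + y \in A} -> {morph f : x y / x + y} ->
    a0 \in A -> T (f a0) != 0 ->
  \sum_(a in A) chi (f a) = 0.
Proof.
move=> AD fD Aa0 Ta0.
have: \sum_(a in A) chi (f a) = - \sum_(a in A) chi (f a).
  have addK x : (x + a0) + a0 = x by rewrite -addrA addrr_pchar2 ?addr0.
  rewrite {1}(reindex_onto (fun x => x + a0) (fun x => x + a0)) //= -sumrN.
  apply: eq_big => [x|x _]; last by rewrite fD chiD {2}/chi Ta0 expr1 mulrN1.
  rewrite addK eqxx andbT; apply/idP/idP=> [Ax|Ax]; last exact: AD.
  by rewrite -[x]addK AD.
lia.
Qed.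

Lemma sum_chi_mul a : a != 0 -> \sum_x chi (a * x) = 0.
Proof.
move=> a0; have [c Tc] := trace_surj.
rewrite -(eq_bigl _ _ (in_setT (T := F))).
apply: (sum_chi_additive (a0 := a^-1 * c)) => [x y||//|].
- by rewrite !inE.
- by move=> x y; rewrite mulrDr.
- by rewrite mulVKf // Tc oner_eq0.
Qed.

Definition perp (A : {set F}) := [set x | [forall a in A, T (a * x) == 0]].

(** Double counting of the sum of chi(a x): summing over x first leaves only a = 0, which gives q;
    summing over a first leaves #|A| for each x in [perp A]. *)
Lemma card_perp (A : {set F}) :
    0 \in A -> {in A &, forall x y, x + y \in A} ->
  (#|A| * #|perp A| = 2 ^ n)%N.
Proof.
move=> A0 AD; apply/eqP; rewrite -eqz_nat; apply/eqP.
have: \sum_x \sum_(a in A) chi (a * x) = (2 ^ n)%N.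
  rewrite exchange_big (bigD1 0) //= [X in _ + X]big1 => [|a /andP[_ a0]].
    rewrite addr0 (eq_bigr _ (fun x _ => congr1 chi (mul0r x))).
    by rewrite chi0 sumr_const cardF natz.
  exact: sum_chi_mul.
move <-; rewrite (bigID [in perp A]) /= [X in _ + X]big1 => [|x].
  rewrite addr0 (eq_bigr (fun=> #|A|%:R)) => [|x].
    by rewrite sumr_const -mulrnA natz.
  rewrite inE => /'forall_implyP perpx; rewrite -sumr_const.
  by apply: eq_bigr => a /perpx; rewrite -chi_eq1 => /eqP.
rewrite inE negb_forall => /existsP[a0]; rewrite negb_imply => /andP[Aa0 Ta0].
by apply: (sum_chi_additive (f := *%R^~ x)) Ta0 => // y z; rewrite mulrDl.
Qed.

(** * The counts N(a, b) and their relation to Kloosterman sums *)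

Definition tcount (a b : F) : nat :=
  #|[set x | [&& T (a * x) == 1, T (b * x) == 1 & T x^-1 == 1]]|.

(** For bits s and t, the bit of s + t mod 2 plus 2 s t equals s + t; this is summed over the x with
    T(1 / x) = 1. *)
Lemma tcountD a b :
  (tcount (a + b)%R (a + b)%R + (tcount a b).*2 = tcount a a + tcount b b)%N.
Proof.
have cardE (P : pred F) : #|[set x | P x]| = (\sum_x P x)%N.
  by rewrite -sum1_card big_mkcond; apply: eq_bigr => x _; rewrite inE; case: (P x).
rewrite /tcount !cardE -muln2 big_distrl /=.
rewrite -!big_split /=.
apply: eq_bigr => x _; rewrite mulrDl ftraceD //.
by case/orP: (trace_bool (a * x)) => /eqP->; case/orP: (trace_bool (b * x)) => /eqP->;
  rewrite ?addr0 ?add0r ?addrr_pchar2 ?eqxx ?[0 == 1]eq_sym ?oner_eq0 //=;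
  case: (T _ == 1).
Qed.

Lemma card_neq0 : #|[set x : F | x != 0]|.+1 = (2 ^ n)%N.
Proof.
rewrite -cardF (cardD1 0 F) inE /= add1n; congr _.+1.
by apply: eq_card => x; rewrite !inE andbT.
Qed.

(** Since m < q - 1, some nonzero g has g^m != 1, and the substitution x |-> g x multiplies the sum
    by g^m. *)
Lemma sum_expr m : (0 < m)%N -> (m < (2 ^ n).-1)%N -> \sum_(x : F) x ^+ m = 0.
Proof.
move=> m_gt0 lt_m.
have [g g0 gm] : exists2 g : F, g != 0 & g ^+ m != 1.
  have [g /andP[]|noroot] := pickP (fun g : F => (g != 0) && (g ^+ m != 1)).
    by exists g.
  have: (#|[set x : F | x != 0%R]| < size (('X^m - 1%:P)%R : {poly F}))%N.
    rewrite cardE; apply: max_poly_roots (enum_uniq _).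
      by rewrite -size_poly_gt0 size_XnsubC.
    apply/allP=> x; rewrite mem_enum inE => x0.
    have := noroot x; rewrite /= x0 /= => /negbFE/eqP xm.
    by rewrite /root !hornerE xm subrr.
  by rewrite size_XnsubC // ltnS leqNgt; case/negP; move: lt_m; rewrite -card_neq0.
have: \sum_(x : F) x ^+ m = g ^+ m * \sum_(x : F) x ^+ m.
  rewrite {1}(reindex_inj (mulfI g0)) mulr_sumr /=.
  by apply: eq_bigr => x _; rewrite exprMn.
move/eqP; rewrite -subr_eq0 -{1}[\sum_x _]mul1r -mulrBl mulf_eq0 subr_eq0.
by rewrite eq_sym (negPf gm) => /eqP.
Qed.

Lemma sum_expr_max : \sum_(x : F) x ^+ (2 ^ n).-1 = 1.
Proof.
have q1 : (0 < (2 ^ n).-1)%N.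
  by rewrite -ltnS prednK ?expn_gt0 // -{1}(expn0 2) ltn_exp2l.
have -> : \sum_(x : F) x ^+ (2 ^ n).-1 = #|[set x : F | x != 0]|%:R.
  rewrite -sumr_const [RHS]big_mkcond; apply: eq_bigr => x _ /=.
  rewrite inE; case: (eqVneq x 0) => [->|x0]; first by rewrite expr0n eqn0Ngt q1.
  by apply: (mulfI x0); rewrite -exprS prednK ?expn_gt0 // expr2n_card mulr1.
apply/eqP; rewrite char2_eq -mulrSr card_neq0 natrX.
by rewrite (pcharf0 charF) expr0n eqn0Ngt n_gt0.
Qed.

(** The indicator of the counted set is T(a x) T(b x) T(1 / x), and the first two factors, being 0
    or 1, move inside the third trace. Expanding them gives power sums of exponent 2^i + 2^j - 1,
    which vanish unless the exponent is q - 1, that is i = j = n - 1. *)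
Lemma natr_tcount a b : (tcount a b)%:R = T (a * b) :> F.
Proof.
have traceM t x : T t * T x = T (T t * x).
  by case/orP: (trace_bool t) => /eqP->; rewrite ?mul1r // !mul0r ftrace0.
have -> : (tcount a b)%:R = T (\sum_x T (a * x) * T (b * x) * x^-1).
  rewrite ftrace_sum // /tcount -sum1_card natr_sum [LHS]big_mkcond.
  apply: eq_bigr => x _.
  rewrite inE.
  by case/orP: (trace_bool (a * x)) => /eqP->; case/orP: (trace_bool (b * x)) => /eqP->;
    case/orP: (trace_bool x^-1) => /eqP Tx;
    rewrite ?mul1r ?mul0r ?Tx ?ftrace0 ?eqxx ?[0 == 1]eq_sym ?oner_eq0.
(* This also holds at x = 0, because the exponent on the right is positive. *)
have Dx (x : F) i j : x ^+ (2 ^ i) * x ^+ (2 ^ j) * x^-1 = x ^+ (2 ^ i + 2 ^ j).-1.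
  rewrite -exprD; have [->|x0] := eqVneq x 0.
    rewrite invr0 mulr0 expr0n; case: eqP => //.
    have := expn_gt0 2 i; have := expn_gt0 2 j; lia.
  rewrite -{1}(@prednK (2 ^ i + 2 ^ j)) ?addn_gt0 ?expn_gt0 //.
  by rewrite exprSr mulfK.
have -> : \sum_x T (a * x) * T (b * x) * x^-1 =
    \sum_(i < n) \sum_(j < n) a ^+ (2 ^ i) * b ^+ (2 ^ j) *
      \sum_(x : F) x ^+ (2 ^ i + 2 ^ j).-1.
  transitivity (\sum_(x : F) \sum_(i < n) \sum_(j < n)
      a ^+ (2 ^ i) * b ^+ (2 ^ j) * x ^+ (2 ^ i + 2 ^ j).-1).
    apply: eq_bigr => x _; rewrite -mulrA mulr_suml; apply: eq_bigr => i _.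
    rewrite mulrCA mulr_suml; apply: eq_bigr => j _.
    by rewrite -Dx !exprMn; ring.
  rewrite exchange_big; apply: eq_bigr => i _; rewrite exchange_big.
  by apply: eq_bigr => j _; rewrite mulr_sumr.
have lt_l : (n.-1 < n)%N by rewrite prednK.
pose l := Ordinal lt_l.
have pow_le (i : 'I_n) : (2 ^ i <= 2 ^ n.-1)%N by rewrite leq_exp2l // -ltnS prednK.
have Dq : (2 ^ n = 2 ^ n.-1 + 2 ^ n.-1)%N.
  by rewrite -{1}(prednK n_gt0) expnS mul2n -addnn.
have S0 (i j : 'I_n) : (i != l) || (j != l) -> \sum_(x : F) x ^+ (2 ^ i + 2 ^ j).-1 = 0.
  move=> ijl; apply: sum_expr.
    have := expn_gt0 2 i; have := expn_gt0 2 j; lia.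
  suff: (2 ^ i + 2 ^ j < 2 ^ n)%N.
    have := expn_gt0 2 i; have := expn_gt0 2 j; lia.
  have pow_lt (k : 'I_n) : k != l -> (2 ^ k < 2 ^ n.-1)%N.
    by move=> kl; rewrite ltn_exp2l // ltn_neqAle kl -ltnS prednK /=.
  have := pow_le i; have := pow_le j.
  case/orP: ijl => /pow_lt; lia.
rewrite (bigD1 l) //= [X in _ + X]big1 => [|i il]; last first.
  by apply: big1 => j _; rewrite S0 ?il // mulr0.
rewrite addr0 (bigD1 l) //= [X in _ + X]big1 => [|j jl]; last first.
  by rewrite (S0 l j) ?jl ?orbT // mulr0.
by rewrite addr0 -Dq sum_expr_max mulr1 -exprMn trace_exp2n.
Qed.

Lemma Kloosterman_chi a : Kloosterman charF a = \sum_x chi (x^-1 + a * x).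
Proof.
apply: eq_bigr => x _; rewrite /chi; have := absTr_Frobenius charF cardF (x^-1 + a * x).
rewrite -/(ftrace n _) => <-; rewrite /absTr; case: (_ != 0).
  by rewrite scale1r oner_eq0.
by rewrite scale0r eqxx.
Qed.

(** Pointwise, chi(u + v) = 4 [T(u) = T(v) = 1] - 1 + chi(u) + chi(v); with u = a x and v = 1 / x,
    the last two terms sum to 0 over x. *)
Lemma Kloosterman_tcount a :
  a != 0 -> Kloosterman charF a = (4 * tcount a a)%:R - (2 ^ n)%:R.
Proof.
move=> a0; have sumT : \sum_x chi x = 0.
  by rewrite -[RHS](sum_chi_mul (oner_neq0 F)); apply: eq_bigr => x _; rewrite mul1r.
have sumV : \sum_x chi x^-1 = 0.
  by rewrite -[RHS]sumT [RHS](reindex_inj (@invr_inj F)).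
have sum1 : \sum_(x : F) 1 = (2 ^ n)%:R :> int by rewrite sumr_const cardF.
have -> : tcount a a =
    (\sum_x [&& T (a * x)%R == 1%R, T (a * x)%R == 1%R & T x^-1 == 1%R])%N.
  rewrite /tcount -sum1_card big_mkcond; apply: eq_bigr => x _.
  by rewrite inE; case: [&& _, _ & _].
rewrite Kloosterman_chi -sum1 natrM mulr_natl natr_sum -sumrMnl -sumrB.
rewrite -[RHS]addr0 -[X in _ + X]sumV -[RHS]addr0 -[X in _ + X](sum_chi_mul a0).
rewrite -!big_split /=.
apply: eq_bigr => x _; rewrite chiD /chi.
by case/orP: (trace_bool (a * x)) => /eqP->; case/orP: (trace_bool x^-1) => /eqP->;
  rewrite ?eqxx ?[0 == 1]eq_sym ?oner_eq0.
Qed.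

Lemma expn_sub2 m : (1 < m)%N -> (2 ^ m = 4 * 2 ^ (m - 2))%N.
Proof. by move=> m_gt1; rewrite -(expnD 2 2) subnKC. Qed.

(** * Self-orthogonality of a space of zeros *)

Section ZeroSpace.

Variables (A : {set F}) (n_gt4 : (4 < n)%N).
Hypotheses (A0 : 0 \in A) (AD : {in A &, forall x y, x + y \in A}).
Hypothesis KA : {in A, forall a, Kloosterman charF a = 0}.

Lemma tcount_diag a : a \in A -> a != 0 -> tcount a a = (2 ^ (n - 2))%N.
Proof.
move=> Aa a0; have := Kloosterman_tcount a0; rewrite KA // !natz => /eqP.
rewrite eq_sym subr_eq0 eqz_nat (expn_sub2 (ltnW (ltnW (ltnW n_gt4)))).
by rewrite eqn_pmul2l // => /eqP.
Qed.

Lemma dvd4_tcount a : a \in A -> (4 %| tcount a a)%N.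
Proof.
move=> Aa; have [->|a0] := eqVneq a 0.
  by rewrite /tcount eq_card0 // => x; rewrite inE mul0r ftrace0 eq_sym oner_eq0.
by rewrite tcount_diag // expn_sub2 ?dvdn_mulr // ltn_subRL ltnW.
Qed.

(** By [tcountD], 2 N(a, b) is a combination of three diagonal counts, all divisible by 4. *)
Lemma tcount_even a b : a \in A -> b \in A -> ~~ odd (tcount a b).
Proof.
move=> Aa Ab; have := tcountD a b.
have := dvd4_tcount Aa; have := dvd4_tcount Ab; have := dvd4_tcount (AD Aa Ab).
lia.
Qed.

Lemma odd_tcount a b : odd (tcount a b) = (T (a * b) != 0).
Proof.
by rewrite -natr_tcount -(odd_double_half (tcount a b)) -mul2n natrD natrM
  (pcharf0 charF) mul0r addr0 oddD oddM /= addbF oddb; case: odd; rewrite ?oner_eq0 ?eqxx.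
Qed.

Lemma trace_mul a b : a \in A -> b \in A -> T (a * b) = 0.
Proof. by move=> Aa Ab; apply/eqP; rewrite -[_ == 0]negbK -odd_tcount tcount_even. Qed.

Lemma sub_perp : A \subset perp A.
Proof.
apply/subsetP=> a Aa; rewrite inE; apply/'forall_implyP=> b Ab.
by rewrite trace_mul.
Qed.

Lemma trace_zero a : a \in A -> T a = 0.
Proof. by move=> Aa; rewrite -trace_sqr expr2 trace_mul. Qed.

Lemma mem1_perp : 1 \in perp A.
Proof. by rewrite inE; apply/'forall_implyP=> b Ab; rewrite mulr1 trace_zero. Qed.

Lemma card_sqr_le : (#|A| ^ 2 <= 2 ^ n)%N.
Proof.
rewrite -(card_perp A0 AD) -mulnn leq_mul2l.
by rewrite subset_leq_card ?sub_perp ?orbT.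
Qed.

Lemma perp_eq : (#|A| ^ 2 = 2 ^ n)%N -> perp A = A.
Proof.
have A_gt0 : (0 < #|A|)%N by apply/card_gt0P; exists 0.
rewrite -(card_perp A0 AD) -mulnn => /eqP; rewrite eqn_pmul2l //.
by move=> cardA; apply/esym/eqP; rewrite eqEcard sub_perp (eqP cardA) leqnn.
Qed.

End ZeroSpace.

(** * The sets counted by N(1, 1) over subfields, and the 2-adic valuation of their sizes *)

Definition bitrace k :=
  [set x : F | [&& x ^+ (2 ^ k) == x, ftrace k x == 1 & ftrace k x^-1 == 1]].

Lemma add_inv_eq (x y : F) : x != 0 -> y != 0 ->
  (x + x^-1 == y + y^-1) = (x == y) || (x == y^-1).
Proof.
move=> x0 y0; rewrite [LHS]char2_eq [x == y]char2_eq [x == y^-1]char2_eq -mulf_eq0.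
have -> : (x + y) * (x + y^-1) = x * (x + x^-1 + (y + y^-1)).
  by rewrite !mulrDr !mulrDl !mulfV //; ring.
by rewrite mulf_eq0 (negPf x0).
Qed.

Lemma inv_fixed (x : F) : x != 0 -> x^-1 = x -> x = 1.
Proof.
move=> x0 Dx; apply/eqP; rewrite char2_eq -[_ == 0](expf_eq0 _ 2).
by rewrite (expr2nD 1) expr1n expr2 -{1}Dx mulVf // addrr_pchar2.
Qed.

Lemma expr2n_inj i : injective (fun x : F => x ^+ (2 ^ i)).
Proof.
move=> x y /= /eqP; rewrite char2_eq -expr2nD expf_eq0 -char2_eq.
by case/andP=> _ /eqP.
Qed.

Lemma iter_exp2n m i (x : F) : iter i (fun y => y ^+ (2 ^ m)) x = x ^+ (2 ^ (i * m)).
Proof. by elim: i => //= i ->; rewrite -exprM -expnD addnC. Qed.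

(** Inversion is an involution of this set whose only fixed point is 1. *)
Lemma odd_bitrace m : odd m -> odd #|bitrace m|.
Proof.
move=> m_odd; have T1 := ftrace1_odd m_odd.
have X1 : 1 \in bitrace m by rewrite inE invr1 T1 expr1n eqxx.
rewrite (cardsD1 1) X1 /= -dvdn2.
apply: (@dvdn_card_iter _ (@GRing.inv F) _ 2 0) => // x; rewrite !inE.
- case/and4P=> x1 xm Tx Tx'; rewrite invr_eq1 x1 invrK Tx Tx' !andbT /=.
  by rewrite exprVn (eqP xm).
- by move=> _ /=; rewrite invrK.
case/and4P=> x1 _ Tx _; apply: contra x1 => /= /eqP Dx.
have x0 : x != 0 by apply: contraTneq Tx => ->; rewrite ftrace0 eq_sym oner_eq0.
by rewrite (inv_fixed x0 Dx).
Qed.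

(** The map x |-> x + 1 / x is two-to-one from [bitrace (k + k)] onto [V]. The part of [V] in the
    subfield of 2^k elements is [bitrace k], and the rest splits into Frobenius orbits of length
    2^(j+1). *)
Lemma card_bitrace_double m j (k := (2 ^ j * m)%N) : (k + k %| n)%N ->
  exists c, #|bitrace (k + k)| = (2 * (#|bitrace k| + 2 ^ j.+1 * c))%N.
Proof.
case/dvdnP=> r Dn; pose h (x : F) := x + x^-1; pose V := h @: bitrace (k + k).
pose K := [set w : F | w ^+ (2 ^ k) == w].
have X_neq0 x : x \in bitrace (k + k) -> x != 0.
  rewrite inE => /and3P[_ Tx _]; apply: contraTneq Tx => ->.
  by rewrite ftrace0 eq_sym oner_eq0.
have X_notK x : x \in bitrace (k + k) -> x ^+ (2 ^ k) != x.
  rewrite inE => /and3P[_ Tx _]; apply: contraTneq Tx => xk.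
  by rewrite ftrace_double // eq_sym oner_eq0.
have cardX : #|bitrace (k + k)| = (#|V| * 2)%N.
  rewrite -[LHS]sum1_card (partition_big_imset h) /= -/V.
  rewrite (eq_bigr (fun=> 2%N)) ?sum_nat_const // => _ /imsetP[y Xy ->].
  have y0 := X_neq0 y Xy.
  have yy' : y != y^-1.
    apply: contra (X_notK y Xy) => /eqP/esym/(inv_fixed y0) ->.
    by rewrite expr1n.
  have := cards2 y y^-1; rewrite yy' => <-; rewrite -sum1_card.
  apply: eq_bigl => x; rewrite in_set2; apply/andP/idP => [[Xx]|].
    by rewrite add_inv_eq ?X_neq0.
  case/orP=> /eqP->; split=> //; last by rewrite /h invrK addrC.
  by move: Xy; rewrite !inE invrK exprVn (inj_eq invr_inj) => /and3P[-> -> ->].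
have T_sqr (u : F) : (ftrace k u == 1) = (ftrace k (u ^+ 2) == 1).
  have := ftrace_exp2n k 1 u; rewrite expn1 => ->.
  by rewrite -[in RHS](expr1n _ (2 ^ 1)) (inj_eq (@expr2n_inj 1)).
(* If w = x + 1 / x lies in the subfield while x does not, the conjugate of x is 1 / x, so the trace
   of x at level 2k is that of w at level k. *)
have VK : V :&: K = bitrace k.
  apply/setP=> w; apply/setIP/idP.
    case=> /imsetP[x Xx Dw]; rewrite inE => wK.
    have x0 := X_neq0 x Xx; have xk : x ^+ (2 ^ k) = x^-1.
      move: wK; rewrite Dw /h expr2nD exprVn add_inv_eq ?expf_neq0 //.
      by rewrite (negPf (X_notK x Xx)) => /eqP.
    have Tw : ftrace k w == 1.
      move: Xx; rewrite inE => /and3P[_ Tx _].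
      by rewrite Dw ftraceD -xk -ftrace_add.
    have w0 : w != 0 by apply: contraTneq Tw => ->; rewrite ftrace0 eq_sym oner_eq0.
    have xw : x * x + x * w = 1.
      by rewrite Dw /h mulrDr mulfV // addrA addrr_pchar2 ?add0r.
    rewrite inE wK Tw T_sqr.
    (* In this Artin-Schreier form the trace at level k telescopes to (1 / x + x) / w = 1. *)
    have -> : w^-1 ^+ 2 = (x / w) ^+ 2 + x / w.
      by rewrite -[LHS]mul1r -xw; field.
    rewrite ftraceAS exprMn exprVn xk (eqP wK) -mulrDl addrC.
    by rewrite -/(h x) -Dw mulfV // eqxx.
  rewrite inE => /and3P[/eqP wk /eqP Tw]; rewrite T_sqr => /eqP Tw'.
  have w0 : w != 0.
    by apply: contra_eq_neq Tw => ->; rewrite ftrace0 eq_sym oner_eq0.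
  have wk' : (w^-1 ^+ 2) ^+ (2 ^ k) = w^-1 ^+ 2.
    by rewrite -exprM mulnC exprM exprVn wk.
  (* The element 1 / w^2 lies in the subfield and n is an even multiple of k, so its absolute trace
     vanishes. *)
  have /trace0_AS[y Dy] : T (w^-1 ^+ 2) = 0.
    rewrite [n in ftrace n _]Dn ftraceM ?ftrace_double ?mul0rn //.
    by rewrite expnD exprM !wk'.
  have yk : y ^+ (2 ^ k) = y + 1.
    by apply/eqP; rewrite char2_eq addrA -ftraceAS -Dy Tw' addrr_pchar2.
  have y1 : w ^+ 2 * (y ^+ 2 + y) = 1 by rewrite -Dy exprVn mulfV ?expf_neq0.
  (* Scaling by w turns y^2 + y = 1 / w^2 into x^2 + w x = 1, that is x + 1 / x = w. *)
  pose x := w * y; have x1 : x * (x + w) = 1 by rewrite -y1 /x; ring.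
  have x0 : x != 0.
    by apply: contra_eq_neq x1 => ->; rewrite mul0r eq_sym oner_eq0.
  have xV : x^-1 = x + w by apply: (mulfI x0); rewrite mulfV.
  have xk : x ^+ (2 ^ k) = x^-1 by rewrite exprMn wk yk xV /x; ring.
  have Dw : w = x + x^-1 by rewrite xV addrA addrr_pchar2 ?add0r.
  have xX : x \in bitrace (k + k).
    rewrite inE !ftrace_add exprVn xk invrK expnD exprM xk exprVn xk invrK.
    by rewrite [ftrace k x^-1 + _]addrC -ftraceD -Dw Tw !eqxx.
  by split; [apply/imsetP; exists x | rewrite inE wk].
(* Iterating y |-> y^(2^m), 2^(j+1) times gives the power 2^(2k), which fixes [V], and 2^j times the
   power 2^k, which fixes only elements of [K]. *)
have VD : (2 ^ j.+1 %| #|V :\: K|)%N.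
  have kE : (2 ^ j.+1 * m = k + k)%N by rewrite expnS -mulnA mul2n addnn.
  apply: (@dvdn_card_iter _ (fun y : F => y ^+ (2 ^ m))) => // w.
  - rewrite !in_setD => /andP[]; rewrite !inE => wK /imsetP[x Xx Dw]; apply/andP; split.
      apply: contra wK => /eqP; rewrite -exprM mulnC exprM.
      by move/(@expr2n_inj m) => ->.
    apply/imsetP; exists (x ^+ (2 ^ m)); last by rewrite Dw /h expr2nD exprVn.
    move: Xx; rewrite !inE -exprVn !ftrace_exp2n -exprM mulnC exprM.
    by case/and3P=> /eqP-> /eqP-> /eqP->; rewrite expr1n !eqxx.
  - rewrite inE iter_exp2n kE => /andP[_ /imsetP[x Xx ->]].
    move: Xx; rewrite inE => /and3P[/eqP xk _ _].
    by rewrite /h expr2nD // exprVn xk.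
  - by rewrite !inE iter_exp2n => /andP[].
have /dvdnP[c Dc] := VD; exists c.
by rewrite cardX -(cardsID K V) VK Dc mulnC [(c * _)%N]mulnC.
Qed.

Lemma card_bitrace m j : odd m -> (2 ^ j * m %| n)%N ->
  exists c, #|bitrace (2 ^ j * m)| = (2 ^ j * (c.*2).+1)%N.
Proof.
move=> m_odd; elim: j => [_|j IHj].
  exists (#|bitrace (1 * m)|)./2; rewrite mul1n -[LHS]odd_double_half.
  by rewrite mul1n odd_bitrace.
rewrite expnS -mulnA mul2n -addnn => dvd_n.
have [|c1 E1] := IHj; first by apply: dvdn_trans dvd_n; rewrite dvdn_addr.
have [c2 ->] := card_bitrace_double dvd_n; exists (c1 + c2)%N.
rewrite E1 expnS; lia.
Qed.

(** K(1) = 0 would force N(1, 1) = 2^(n-2), whose valuation is that of n; then 2^(n-2) would divide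
    n, but n < 2^(n-2) for n >= 5. *)
Lemma Kloosterman1_neq0 : (4 < n)%N -> Kloosterman charF 1 != 0.
Proof.
move=> n_gt4; rewrite Kloosterman_tcount ?oner_neq0 //.
have -> : tcount 1 1 = #|bitrace n|.
  apply: eq_card => x; rewrite !inE mul1r expr2n_card eqxx.
  by case: (_ == 1).
have [m m_odd Dn] := pfactor_coprime (isT : prime 2) n_gt0.
rewrite coprime2n in m_odd; set s := logn 2 n in Dn.
have [|c] := @card_bitrace m s m_odd; first by rewrite mulnC -Dn.
rewrite mulnC -Dn => ->; rewrite subr_eq0 !natz eqz_nat.
have lt_n2 : (n < 2 ^ (n - 2))%N.
  have -> : n = (5 + (n - 5))%N by lia.
  by elim: (n - 5)%N => // i IHi; rewrite addnS subSn // expnS; lia.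
apply/eqP=> E; have dvd2 : (2 ^ (n - 2) %| 2 ^ s)%N.
  rewrite -(@Gauss_dvdl _ _ (c.*2).+1) ?coprimeXl ?coprime2n /= ?odd_double //.
  apply/dvdnP; exists 1%N; apply/eqP; rewrite -(eqn_pmul2l (isT : 0 < 4)%N) E mul1n.
  by rewrite -expn_sub2 ?(ltnW (ltnW (ltnW n_gt4))).
have : (2 ^ s %| n)%N by rewrite Dn dvdn_mull.
move/(dvdn_trans dvd2)/dvdn_leq => /(_ n_gt0); lia.
Qed.

(** * The cubic sum modulo 5, by 5-torsion on an elliptic curve *)

Definition cubic_sum : int := \sum_x chi (x ^+ 3 + x).

(* In the coordinates u = (y + 1) / x, v = y / x, translation by the point (0, 0)
   of the elliptic curve y^2 + y = x^3 + x is the Lyness map, which has period 5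
   in every characteristic. *)
Definition lyness (p : F * F) := (p.2, (1 + p.2) / p.1).

(** In the coordinates u and v, these are the points with x != 0, 1. The excluded points, with the
    point at infinity, form the subgroup of order 5 generated by (0, 0). *)
Definition lyness_curve := [set p : F * F |
  [&& p.1 != 0, p.2 != 0 & 1 + p.1 ^+ 2 + p.2 ^+ 2 + p.1 * p.2 * (p.1 + p.2) == 0]].

(** The Lyness orbit is u, v, (1 + v) / u, (1 + u + v) / (u v), (1 + u) / v: these factors are all
    that its five steps divide by. *)
Lemma lyness_curve_neq0 (u v : F) : (u, v) \in lyness_curve ->
  [/\ u != 0, v != 0, 1 + u != 0, 1 + v != 0 & 1 + u + v != 0].
Proof.
rewrite inE => /and3P[/= u0 v0 /eqP Cuv]; split=> //; apply/negP=> /eqP E.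
- have Du : u = 1 by apply/eqP; rewrite eq_sym char2_eq E.
  case/eqP: v0; rewrite -Cuv Du; ring: char2_eq0.
- have Dv : v = 1 by apply/eqP; rewrite eq_sym char2_eq E.
  case/eqP: u0; rewrite -Cuv Dv; ring: char2_eq0.
have uv1 : u + v = 1 by apply/eqP; rewrite char2_eq addrC addrA E.
case/eqP: (mulf_neq0 u0 v0); rewrite -Cuv.
have -> : 1 + u ^+ 2 + v ^+ 2 = (1 + u + v) ^+ 2 by ring: char2_eq0.
by rewrite E uv1 expr0n add0r mulr1.
Qed.

Lemma dvd5_lyness_curve : (5 %| #|lyness_curve|)%N.
Proof.
apply: (@dvdn_card_iter _ lyness _ 5 0) => // p; case: p => u v Cuv.
- have [u0 v0 _ v1 _] := lyness_curve_neq0 Cuv.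
  move: Cuv; rewrite !inE /= => /and3P[_ _ /eqP Cuv].
  rewrite v0 mulf_neq0 ?invr_eq0 //=.
  (* The identity is lifted to arbitrary characteristic for [field]; the explicit multiple of 1 + 1
     then vanishes. *)
  have -> : 1 + v ^+ 2 + ((1 + v) / u) ^+ 2 + v * ((1 + v) / u) * (v + (1 + v) / u)
      = (1 + v) / u ^+ 2 * (1 + u ^+ 2 + v ^+ 2 + u * v * (u + v))
        + (1 + 1) * ((v * (1 + v) - u ^+ 2 * v) / u ^+ 2) by field.
  by rewrite Cuv mulr0 char2_eq0 mul0r addr0.
- have [u0 v0 u1 v1 uv1] := lyness_curve_neq0 Cuv.
  have uv1' : u + (1 + v) != 0 by rewrite addrCA addrA.
  have uv1'' : u * v + (u + (1 + v)) != 0.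
    by rewrite (_ : _ + _ = (1 + u) * (1 + v)) ?mulf_neq0 //; ring.
  rewrite /lyness /=; congr (_, _); field.
    by rewrite u0 v0 v1 uv1'.
  by rewrite u0 v0 v1 uv1' uv1''.
apply/eqP=> -[Duv _]; move: Cuv; rewrite inE /= Duv => /and3P[_ _].
by rewrite (_ : _ + _ = 1) ?oner_eq0 //; ring: char2_eq0.
Qed.

(** The change of coordinates is injective since u + v = 1 / x. Each x carries 1 + chi(x^3 + x)
    points, and the excluded values 0 and 1 account for two each. *)
Lemma card_lyness_curve :
  #|lyness_curve|%:R = (2 ^ n)%:R + cubic_sum - 4 :> int.
Proof.
pose P := [set p : F * F | [&& p.1 != 0, p.1 != 1 & p.2 ^+ 2 + p.2 == p.1 ^+ 3 + p.1]].
pose g (p : F * F) := ((p.2 + 1) / p.1, p.2 / p.1).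
pose g' (p : F * F) := ((p.1 + p.2)^-1, p.2 / (p.1 + p.2)).
have gK : {in P, cancel g g'}.
  move=> [x y]; rewrite inE /= => /and3P[x0 _ _].
  have E : (y + 1) / x + y / x = x^-1.
    by rewrite -mulrDl [y + 1]addrC -addrA addrr_pchar2 // addr0 mul1r.
  by rewrite /g' /g /= E invrK mulfVK.
have curveE : lyness_curve = g @: P.
  apply/setP=> p; apply/idP/imsetP=> [|[[x y] Pxy ->{p}]].
    case: p => u v Cuv; have [u0 v0 _ _ uv1] := lyness_curve_neq0 Cuv.
    move: Cuv; rewrite inE => /and3P[_ _ /= /eqP Cuv].
    have uv0 : u + v != 0.
      apply: contra_eq_neq Cuv => uv0; rewrite uv0 mulr0 addr0 -addrA.
      by rewrite -(expr2nD 1) uv0 expr0n addr0 oner_neq0.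
    exists (g' (u, v)).
      rewrite inE /= invr_eq0 uv0 invr_eq1 [_ == 1]char2_eq addrC addrA uv1 char2_eq.
      have -> : (v / (u + v)) ^+ 2 + v / (u + v) + ((u + v)^-1 ^+ 3 + (u + v)^-1)
          = (1 + u ^+ 2 + v ^+ 2 + u * v * (u + v)
             + (1 + 1) * (u * v ^+ 2 + v ^+ 3 + u * v)) / (u + v) ^+ 3 by field.
      by rewrite Cuv char2_eq0 mul0r addr0 mul0r eqxx.
    rewrite /g /g' /= invrK divfK // mulrDl divfK // mul1r addrC -addrA.
    by rewrite addrr_pchar2 ?addr0.
  move: Pxy; rewrite inE /= => /and3P[x0 x1 /eqP Pxy].
  have : x ^+ 3 + x != 0.
    have -> : x ^+ 3 + x = x * (x + 1) ^+ 2 by ring: char2_eq0.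
    by rewrite mulf_neq0 // expf_neq0 // -char2_eq.
  rewrite -Pxy (_ : y ^+ 2 + y = (y + 1) * y) 1?mulf_eq0 1?negb_or; last by ring.
  case/andP=> y1 y0; rewrite inE /= !mulf_neq0 ?invr_eq0 //=.
  have -> : 1 + ((y + 1) / x) ^+ 2 + (y / x) ^+ 2
        + (y + 1) / x * (y / x) * ((y + 1) / x + y / x)
      = (y ^+ 2 + y + (x ^+ 3 + x)
         + (1 + 1) * (x * y ^+ 2 + x * y + y ^+ 3 + y ^+ 2)) / x ^+ 3 by field.
  by rewrite Pxy addrr_pchar2 // char2_eq0 mul0r addr0 mul0r.
rewrite curveE card_in_imset; last exact: can_in_inj gK.
have -> : #|P| = (\sum_(x | (x != 0%R) && (x != 1%R)) (T (x ^+ 3 + x)%R == 0%R).*2)%N.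
  under eq_bigr do rewrite -card_AS -sum1_card.
  rewrite pair_big_dep -sum1_card; apply: eq_bigl => p.
  by rewrite !inE andbA.
rewrite natr_sum (eq_bigr (fun x => 1 + chi (x ^+ 3 + x))) => [|x _]; last first.
  by rewrite /chi; case: (_ == 0).
have: \sum_x (1 + chi (x ^+ 3 + x)) = (2 ^ n)%:R + cubic_sum.
  by rewrite big_split /= sumr_const cardF.
move <-; rewrite [in RHS](bigD1 0) //= [in RHS](bigD1 1) ?oner_neq0 //=.
rewrite !expr1n addrr_pchar2 // expr0n addr0 chi0.
by set R := \sum_(_ | _) _; ring.
Qed.

(** * The cubic sum when 2 dim W = n - 1 *)

Section OddDegree.

Variables (A : {set F}) (n_gt4 : (4 < n)%N).
Hypotheses (A0 : 0 \in A) (AD : {in A &, forall x y, x + y \in A}).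
Hypothesis KA : {in A, forall a, Kloosterman charF a = 0}.
Hypotheses (n_odd : odd n) (cardA : (#|A| ^ 2 * 2 = 2 ^ n)%N).

(** [perp A] has twice the size of [A] and contains the disjoint sets [A] and A + 1, so it is their
    union; as T(1) = 1 for odd n, the trace tells them apart. *)
Lemma perp_trace0 h : h \in perp A -> T h = 0 -> h \in A.
Proof.
have T1 : T 1 = 1 := ftrace1_odd n_odd.
have TA := trace_zero n_gt4 A0 AD KA.
pose A1 := [set a + 1 | a in A].
have dis : A :&: A1 = set0.
  apply/setP=> x; rewrite inE in_set0; apply/negP=> /andP[Ax /imsetP[a Aa Dx]].
  by have /eqP := TA _ Ax; rewrite Dx ftraceD T1 TA // add0r oner_eq0.
have perpD : perp A = A :|: A1.
  apply/esym/eqP; rewrite eqEcard; apply/andP; split.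
    apply/subUsetP; split; first exact: sub_perp.
    apply/subsetP=> _ /imsetP[a Aa ->]; rewrite inE; apply/'forall_implyP=> b Ab.
    rewrite mulrDr mulr1 ftraceD (trace_mul n_gt4 A0 AD KA) //.
    by rewrite TA // addr0.
  rewrite cardsU dis cards0 subn0 card_imset; last exact: addIr.
  have A_gt0 : (0 < #|A|)%N by apply/card_gt0P; exists 0.
  by rewrite -(leq_pmul2l A_gt0) (card_perp A0 AD) -cardA -mulnn addnn -muln2 mulnA.
rewrite perpD => /setUP[//|/imsetP[a Aa ->]].
by rewrite ftraceD T1 TA // add0r => /eqP; rewrite oner_eq0.
Qed.

(** By Frobenius invariance [tcountD] reads N(w, w) + 2 N(v^2, v) = 2 N(v, v) with w = v^2 + v. As 4
    divides N(w, w), the counts N(v^2, v) and N(v, v) have equal parity, so T(v^3) = T(v). *)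
Lemma trace_cube_AS (v : F) : v ^+ 2 + v \in A -> T (v ^+ 3 + v) = 0.
Proof.
move=> Aw; have := tcountD (v ^+ 2) v.
have := dvd4_tcount n_gt4 KA Aw.
have -> : tcount (v ^+ 2) (v ^+ 2) = tcount v v.
  rewrite /tcount -!sum1_card (reindex_inj (@expr2n_inj 1)); apply: eq_bigl => x.
  by rewrite !inE -exprMn -exprVn !trace_sqr.
have := odd_tcount (v ^+ 2) v; have := odd_tcount v v.
rewrite -exprSr -expr2 trace_sqr => oddv oddv3 dvd4 E.
have oddE : odd (tcount v v) = odd (tcount (v ^+ 2) v).
  by move: dvd4 E; set c := tcount (_ + _) _; lia.
rewrite ftraceD; move: oddE; rewrite oddv oddv3.
by case/orP: (trace_bool v) => /eqP->; case/orP: (trace_bool (v ^+ 3)) => /eqP->;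
  rewrite ?eqxx ?oner_eq0 ?addr0 ?addrr_pchar2.
Qed.

(** The sum is averaged over the translations by [V]. The inner sum over v vanishes unless c^2 + c
    is orthogonal to [A]; having trace 0 it is then in [A], so c is in [V] and contributes #|V|. *)
Lemma cubic_sum_eq : cubic_sum = (#|A| * 2)%:R.
Proof.
pose V := [set v : F | v ^+ 2 + v \in A].
have VD : {in V &, forall x y, x + y \in V}.
  move=> x y; rewrite !inE => Vx Vy; have := AD Vx Vy.
  by congr (_ \in A); rewrite (expr2nD 1); ring.
have cardV : #|V| = (#|A| * 2)%N.
  pose AS (y : F) := y ^+ 2 + y.
  rewrite -[LHS]sum1_card (partition_big AS [in A]) /= => [|x]; last by rewrite inE.
  rewrite (eq_bigr (fun=> 2%N)) ?sum_nat_const // => w Aw.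
  have := card_AS w; rewrite (trace_zero n_gt4 A0 AD KA Aw) eqxx => card2.
  rewrite -[RHS]card2 -sum1_card; apply: eq_bigl => x; rewrite !inE.
  by apply/andP/idP=> [[]//|/eqP Dw]; rewrite /AS Dw Aw.
have shift v : v \in V ->
    cubic_sum = \sum_c chi (c ^+ 3 + c) * chi ((c ^+ 2 + c) * (v ^+ 2 + v)).
  rewrite inE => Av; rewrite /cubic_sum (reindex_inj (addIr v)) /=.
  apply: eq_bigr => c _; rewrite -chiD.
  (* The cross terms of the cube agree with (c^2 + c)(v^2 + v) up to (c v)^2 + c v, which has trace
     0. *)
  have -> : (c + v) ^+ 3 + (c + v) = c ^+ 3 + c + (c ^+ 2 + c) * (v ^+ 2 + v)
        + (v ^+ 3 + v + ((c * v) ^+ 2 + c * v))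
        + (1 + 1) * (c ^+ 2 * v + c * v ^+ 2 - c ^+ 2 * v ^+ 2 - c * v) by ring.
  have Tv : T (v ^+ 3 + v + ((c * v) ^+ 2 + c * v)) = 0.
    by rewrite ftraceD trace_cube_AS // traceAS addr0.
  by apply: chi_trace; rewrite char2_eq0 mul0r addr0 [LHS]ftraceD Tv addr0.
have V_gt0 : (0 < #|V|)%N.
  by apply/card_gt0P; exists 0; rewrite inE expr0n addr0.
have: \sum_(v in V) cubic_sum = \sum_(v in V) #|V|%:R.
  rewrite (eq_bigr _ shift) exchange_big /= (bigID [in V]) /= [X in _ + X]big1 ?addr0.
    apply: eq_bigr => c Vc; rewrite -mulr_sumr.
    have Ac : c ^+ 2 + c \in A by move: Vc; rewrite inE.
    have /eqP-> : chi (c ^+ 3 + c) == 1 by rewrite chi_eq1 trace_cube_AS.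
    rewrite mul1r -sumr_const; apply: eq_bigr => v; rewrite inE => Av.
    by apply/eqP; rewrite chi_eq1 (trace_mul n_gt4 A0 AD KA).
  move=> c Vc; rewrite -mulr_sumr.
  have [v Vv Tv] : exists2 v, v \in V & T ((c ^+ 2 + c) * (v ^+ 2 + v)) != 0.
    have [v /andP[]|T0] :=
        pickP (fun v => (v \in V) && (T ((c ^+ 2 + c) * (v ^+ 2 + v)) != 0)).
      by exists v.
    case/negP: Vc; rewrite inE perp_trace0 ?traceAS // inE.
    apply/'forall_implyP=> a Aa.
    have [v Dv] := trace0_AS (trace_zero n_gt4 A0 AD KA Aa).
    by have := T0 v; rewrite inE -Dv Aa mulrC => /negbFE.
  rewrite (sum_chi_additive VD _ Vv Tv) ?mulr0 // => x y.
  by rewrite -mulrDr (expr2nD 1); congr (_ * _); ring.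
by rewrite !sumr_const -cardV => /(Num.Theory.pmulrnI V_gt0).
Qed.

End OddDegree.

End FieldTrace.

(** * Assembly of the dimension bounds *)

Theorem theorem5 (n : nat) (hn : (5 <= n)%N)
    (F : finFieldType) (cardF : #|F| = (2 ^ n)%N) (charF : 2%N \in [pchar F])
    (W : {vspace pPrimeCharType charF})
    (hW : forall v : F, v \in W -> Kloosterman charF v = 0) :
  [/\ (n %% 8)%N \in [:: 0; 2; 4; 6]%N -> (\dim W <= (n - 2) %/ 2)%N,
      (n %% 8)%N \in [:: 1; 7]%N -> (\dim W <= (n - 1) %/ 2)%N &
      (n %% 8)%N \in [:: 3; 5]%N -> (\dim W <= (n - 3) %/ 2)%N].
Proof.
have n_gt0 : (0 < n)%N by apply: leq_trans hn.
pose A : {set F} := [set x : F | (x : pPrimeCharType charF) \in W].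
have A0 : 0 \in A by rewrite inE mem0v.
have AD : {in A &, forall x y, x + y \in A}.
  by move=> x y; rewrite !inE => Wx Wy; apply: memvD.
have KA : {in A, forall a, Kloosterman charF a = 0} by move=> a; rewrite inE => /hW.
have cardA : #|A| = (2 ^ \dim W)%N.
  have := @card_vspace _ F (Vector.on (pPrimeCharType charF)) W.
  by rewrite card_Fp // => <-; apply: eq_card => x; rewrite inE.
have le_dim : (2 * \dim W <= n)%N.
  rewrite -(leq_exp2l _ _ (isT : 1 < 2)%N) mulnC expnM -cardA.
  by rewrite (card_sqr_le n_gt0 cardF hn A0 AD KA).
have ne_dim : (2 * \dim W)%N != n.
  apply/eqP=> Dn; have := mem1_perp n_gt0 cardF hn A0 AD KA.
  rewrite (perp_eq n_gt0 cardF hn A0 AD KA) => [/KA/eqP|].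
    by rewrite (negPf (Kloosterman1_neq0 charF n_gt0 cardF hn)).
  by rewrite cardA -expnM mulnC Dn.
have ne_dim1 : (n %% 8)%N \in [:: 3; 5]%N -> (2 * \dim W).+1 != n.
  move=> n35; apply/eqP=> Dn.
  have cardA2 : (#|A| ^ 2 * 2 = 2 ^ n)%N by rewrite cardA -expnM -expnSr mulnC Dn.
  have n_odd : odd n by rewrite -Dn /= mul2n odd_double.
  have := card_lyness_curve charF n_gt0 cardF.
  rewrite (cubic_sum_eq n_gt0 cardF hn A0 AD KA n_odd cardA2) cardA.
  have := dvd5_lyness_curve charF.
  move: #|lyness_curve F| => N dvdN EN.
  have {EN} : (N + 4 = 2 ^ n + 2 ^ \dim W * 2)%N by lia.
  have mod16 k : (16 ^ k %% 5)%N = 1%N by rewrite -modnXm /= exp1n.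
  (* As 16 = 1 mod 5, only r matters: the right side is 2^(2r+1) + 2^(r+1), that is 2 mod 5 for r =
     1 and 0 for r = 2, while N + 4 is 4 mod 5. *)
  have [k [r [-> -> r12]]] : exists k r, [/\ n = (4 * (2 * k) + r.*2.+1)%N,
      \dim W = (4 * k + r)%N & r \in [:: 1; 2]%N].
    exists (n %/ 8)%N, (\dim W %% 4)%N; move: n35 Dn; rewrite !inE; split; lia.
  have pow16 a b : (2 ^ (4 * a + b) = 16 ^ a * 2 ^ b)%N by rewrite expnD expnM.
  rewrite !pow16; have := mod16 (2 * k)%N; have := mod16 k.
  move: (16 ^ k)%N (16 ^ (2 * k))%N => x y.
  move: r12; rewrite !inE => /orP[]/eqP->; rewrite !doubleS double0.
    by rewrite !expnS expn0; clear -dvdN; lia.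
  by rewrite !expnS expn0; clear -dvdN; lia.
move: (\dim W) le_dim ne_dim ne_dim1 => d; rewrite !inE; clear.
by move=> le_dim ne_dim ne_dim1; split; lia.
Qed.
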